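(* For every nonnegative integer $n$, every integer $\alpha\ge 4$, and every integer $j$ with $0\le j\le (\alpha-4)/2$, $$\overline{A}_{5^\alpha}\bigl(5^{2j}(625n+i)\bigr)\equiv 0 \pmod{5}\qquad\text{for } i\in\{125,500\}.$$
   Context: An overpartition of $n$ is a partition of $n$ in which the first occurrence of each distinct part may be overlined. For a positive integer $\ell$, $\overline{A}_\ell(n)$ denotes the number of overpartitions of $n$ into parts not divisible by $\ell$, with $\overline{A}_\ell(0)=1$; equivalently $$\sum_{n\ge 0}\overline{A}_\ell(n)q^n=\frac{(q^\ell;q^\ell)_\infty^2(q^2;q^2)_\infty}{(q;q)_\infty^2(q^{2\ell};q^{2\ell})_\infty},\qquad (a;q)_\infty=\prod_{k\ge 0}(1-aq^k).$$ *)

(* Defs.v *)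
From mathcomp Require Import all_boot.

Set Implicit Arguments.
Unset Strict Implicit.
Unset Printing Implicit Defensive.

(* A part is a pair (size, overlined?); parts are listed in weakly decreasing
   order, and only the first occurrence of a size may be overlined. *)
Definition is_overpartition (n : nat) (s : seq (nat * bool)) : bool :=
  let parts := unzip1 s in
  [&& sorted geq parts,
      all (fun k => 0 < k) parts,
      sumn parts == n
    & all (fun i => nth false (unzip2 s) i ==>
                      (index (nth 0 parts i) parts == i))
          (iota 0 (size s))].

Definition no_part_divisible (l : nat) (s : seq (nat * bool)) : bool :=
  all (fun k => ~~ (l %| k)) (unzip1 s).

Definition forget_bound (n : nat) (s : n.-bseq ('I_n.+1 * bool)) :
    seq (nat * bool) :=
  [seq (nat_of_ord p.1, p.2) | p <- s].

(* An overpartition of n has at most n parts, each of size at most n, so the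
   bounded sequences below represent all of them, each exactly once
   (see Abar_enum). *)
Definition Abar (l n : nat) : nat :=
  #|[set s : n.-bseq ('I_n.+1 * bool) |
      is_overpartition n (forget_bound s)
      && no_part_divisible l (forget_bound s)]|.

Lemma forget_bound_inj n : injective (@forget_bound n).
Proof.
move=> s t; rewrite /forget_bound => /inj_map e; apply/val_inj/e.
by move=> [i b] [j c] /= [/val_inj -> ->].
Qed.

Lemma forget_bound_surj n s :
  is_overpartition n s -> exists t : n.-bseq ('I_n.+1 * bool), forget_bound t = s.
Proof.
case/and4P=> _ pos /eqP sum_s _.
have le_part k : k \in unzip1 s -> k <= n.
  rewrite -sum_s; elim: (unzip1 s) => //= a r IH; rewrite inE => /orP[/eqP->|/IH h].
    exact: leq_addr.
  exact: leq_trans h (leq_addl _ _).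
have sz : size s <= n.
  have <- : size (unzip1 s) = size s by rewrite size_map.
  rewrite -sum_s; elim: (unzip1 s) pos => //= a r IH /andP[a0 /IH h].
  by rewrite -add1n leq_add.
have szt : size [seq (inord p.1 : 'I_n.+1, p.2) | p <- s] <= n by rewrite size_map.
exists (Bseq szt); rewrite /forget_bound /= -map_comp.
rewrite -[RHS]map_id; apply/eq_in_map => -[k b] ks /=.
by rewrite inordK // ltnS le_part //; apply/mapP; exists (k, b).
Qed.

Lemma Abar_enum l n (ss : seq (seq (nat * bool))) :
  uniq ss ->
  (forall s, (s \in ss) = is_overpartition n s && no_part_divisible l s) ->
  Abar l n = size ss.
Proof.
move=> us mem_ss; rewrite /Abar cardE -(size_map (@forget_bound n)).
apply/eqP; rewrite -uniq_size_uniq ?(map_inj_uniq (@forget_bound_inj n)) ?enum_uniq //.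
move=> s; rewrite mem_ss; apply/idP/mapP => [/andP[os ps]|[t]].
  have [t ts] := forget_bound_surj os.
  by exists t; rewrite // mem_enum inE ts os ps.
by rewrite mem_enum inE => ? ->.
Qed.

(* Main.v *)
(** Write phi = sum over k in Z of (-1)^k q^(k^2). Gauss's identity
    phi = prod (1 - q^k)/(1 + q^k) turns the generating function A of Abar l into
    A(q) phi(q) = phi(q^l). Modulo 5, phi^5 = phi(q^5), so for l = 5 l' one gets
    A(q) phi(q^5) = phi^4 phi(q^l). Keeping the exponents divisible by 5, and using
    r_4(5n) = r_4(n) mod 5, the sum of Abar l (5n) q^n is phi^3 phi(q^l') mod 5.
    The theorem then follows from r_3(25n) = 5 r_3(n) if n = 1, 4 mod 5 and
    r_3(25n) = r_3(n) mod 5 if 5 | n.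

    The two facts on sums of squares come from the six integral quaternions
    q = 1 + 2i, 1 - 2i, ..., 1 - 2k of norm 5: counting the pairs (q, y) with y in
    q Z^4 (resp. y in q Z^3 q^*, for purely imaginary y) and y of given norm in two
    ways reduces them to a finite computation modulo 5 (resp. 25). *)

From Stdlib Require Import ZArith.
Require Import Defs.
From mathcomp Require Import all_boot all_algebra all_field zify ring ssrZ.

Set Implicit Arguments.
Unset Strict Implicit.
Unset Printing Implicit Defensive.

Import GRing.Theory.

(* ssrint rebinds the key %Z to its own int_scope. *)
Delimit Scope Z_scope with Z.

(** * Enumeration of overpartitions *)

Definition part_rel (p q : nat * bool) : bool :=
  (q.1 <= p.1) && (q.2 ==> (p.1 != q.1)).

Definition overlined_first (s : seq (nat * bool)) : bool :=
  all (fun i => nth false (unzip2 s) i ==>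
                  (index (nth 0 (unzip1 s) i) (unzip1 s) == i))
      (iota 0 (size s)).

Lemma overlined_first_cons (p : nat * bool) s :
  overlined_first (p :: s) =
  all (fun q => q.2 ==> (p.1 != q.1)) s && overlined_first s.
Proof.
rewrite /overlined_first /= eqxx implybT /= (iotaDl 1 0) all_map.
have -> : all (fun q => q.2 ==> (p.1 != q.1)) s =
  all (fun i => nth false (unzip2 s) i ==> (p.1 != nth 0 (unzip1 s) i))
      (iota 0 (size s)).
  elim: s => //= q s ->; congr (_ && _).
  by rewrite (iotaDl 1 0) all_map; apply: eq_all => i /=.
rewrite -all_predI; apply: eq_all => i /=.
by case: (nth false _ i) => //=; rewrite add0n; case: (p.1 == _).
Qed.

(** An entry is the first of its size exactly when it differs in size from all earlier entries, so
    the index condition becomes pairwise. In this form it can be split at the head of the list, as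
    the recursive enumeration requires. *)
Lemma is_overpartitionE n s :
  is_overpartition n s =
  [&& pairwise part_rel s, all (fun p => 0 < p.1) s & sumn (unzip1 s) == n].
Proof.
have geq_trans : transitive geq by move=> a b c /= ab ca; apply: leq_trans ab.
have -> : pairwise part_rel s = sorted geq (unzip1 s) && overlined_first s.
  rewrite sorted_pairwise //; elim: s => //= p s ->.
  rewrite overlined_first_cons all_map andbACA; congr (_ && _).
  by rewrite -all_predI; apply: eq_all.
rewrite /is_overpartition -/(overlined_first s) all_map.
by case: (sorted _ _); case: (overlined_first s); rewrite ?andbF ?andbT.
Qed.

Section Enumeration.

Variable l : nat.

Definition bounded_overpartition K n s :=
  [&& pairwise part_rel s, all (fun p => [&& 0 < p.1, p.1 <= K & ~~ (l %| p.1)]) s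
    & sumn (unzip1 s) == n].

Definition not_overlined (K : nat) (s : seq (nat * bool)) := (K, true) \notin s.

(** With [E] listing the overpartitions into parts below [K], this realises the factor 1/(1 - q^K):
    any number of copies of [K], none overlined. [enum_overpartition] then supplies the factor 1 +
    q^K by optionally putting an overlined [K] in front. *)
Fixpoint enum_not_overlined (E : nat -> seq (seq (nat * bool))) K fuel n :=
  E n ++
  if fuel is fuel'.+1 then
    if K <= n then map (cons (K, false)) (enum_not_overlined E K fuel' (n - K))
    else [::]
  else [::].

Fixpoint enum_overpartition K n : seq (seq (nat * bool)) :=
  if K is K'.+1 then
    if l %| K then enum_overpartition K' n else
      let N := enum_not_overlined (enum_overpartition K') K n in
      N n ++ if K <= n then map (cons (K, true)) (N (n - K)) else [::]
  else if n is 0 then [:: [::]] else [::].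

Definition enumerates (E : seq (seq (nat * bool))) P :=
  uniq E /\ forall s, (s \in E) = P s.

Lemma enumerates_cons (E E' : seq (seq (nat * bool))) (P P' : pred (seq (nat * bool))) p :
  enumerates E P -> enumerates E' P' -> (forall s, P s -> p \notin s) ->
  enumerates (E ++ map (cons p) E')
    (fun s => P s || if s is q :: t then (q == p) && P' t else false).
Proof.
move=> [uE mE] [uE' mE'] PP; split.
  rewrite cat_uniq uE map_inj_uniq ?uE'; last by move=> x y [].
  rewrite andbT; apply/hasPn => _ /mapP [t _ ->]; rewrite mE.
  by apply/negP => /PP; rewrite inE eqxx.
move=> s; rewrite mem_cat mE; congr (_ || _).
case: s => [|q t]; first by apply/mapP => -[].
rewrite -mE'; apply/mapP/andP => [[x xE [-> ->]]|[/eqP -> tE]]; first by rewrite eqxx.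
by exists t.
Qed.

Lemma eq_enumerates E P P' : P =1 P' -> enumerates E P -> enumerates E P'.
Proof. by move=> e [u m]; split=> // s; rewrite m e. Qed.

Lemma bounded_overpartition_mem K n s p :
  bounded_overpartition K n s -> p \in s -> [&& 0 < p.1, p.1 <= K & ~~ (l %| p.1)].
Proof. by case/and3P => _ /allP h _ /h. Qed.

Lemma bounded_overpartition_cons K n p s :
  bounded_overpartition K n (p :: s) =
  [&& [&& 0 < p.1, p.1 <= K & ~~ (l %| p.1)], p.1 <= n,
    all (part_rel p) s & bounded_overpartition K (n - p.1) s].
Proof.
rewrite /bounded_overpartition /=.
case: (all (part_rel p) s); case: (pairwise _ _); rewrite ?andbF //=.
case: (all _ s); rewrite ?andbF //= ?andbT.
have -> : (p.1 + sumn (unzip1 s) == n) =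
  (p.1 <= n) && (sumn (unzip1 s) == n - p.1) by lia.
by [].
Qed.

Lemma all_part_rel_max K n b t : bounded_overpartition K n t ->
  all (part_rel (K, b)) t = not_overlined K t.
Proof.
move=> bt; apply/allP/idP => [h|nt [k c] kt]; rewrite /part_rel /=.
  by apply/negP => /h; rewrite /part_rel /= eqxx andbF.
have /and3P [_ /= kK _] := bounded_overpartition_mem bt kt; rewrite kK /=.
by case: c kt => //= kt; apply/eqP => Kk; rewrite -Kk (negPf nt) in kt.
Qed.

(** Case split on the head. If it is smaller than [K.+1], weak decrease bounds all parts by [K];
    otherwise it is a plain [K.+1], after which no [K.+1] may be overlined. *)
Lemma not_overlined_rec K n s : ~~ (l %| K.+1) ->
  bounded_overpartition K.+1 n s && not_overlined K.+1 s =
  bounded_overpartition K n s || (K.+1 <= n) &&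
    (if s is q :: t then (q == (K.+1, false)) &&
       (bounded_overpartition K.+1 (n - K.+1) t && not_overlined K.+1 t) else false).
Proof.
move=> lK; case: s => [|[k b] t]; first by rewrite andbF orbF andbT.
have [->|kK] := eqVneq k K.+1.
  rewrite !bounded_overpartition_cons /= ltnn lK leqnn /= /not_overlined inE !xpair_eqE eqxx.
  case: b => /=; rewrite ?andbF // -/(not_overlined _ _).
  have [bt|] := boolP (bounded_overpartition _ _ t); rewrite ?andbF //=.
  by rewrite (all_part_rel_max _ bt) andbT -andbA andbb.
rewrite xpair_eqE (negPf kK) /= andbF orbF; apply/andP/idP.
  move=> [/and3P [pt /allP at_ sn] _]; rewrite /bounded_overpartition pt sn andbT.
  have := pt; rewrite pairwise_cons => /andP [/allP rt _].
  have kK' : k <= K by have /and3P [_ /= + _] := at_ _ (mem_head _ _); lia.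
  apply/allP => x xt; have /and3P [-> _ ->] := at_ _ xt.
  rewrite andbT /=; move: xt; rewrite inE => /orP [/eqP -> //|/rt /andP [pk _]].
  exact: leq_trans pk kK'.
move=> bs; split; last first.
  by apply/negP => /(bounded_overpartition_mem bs) /=; rewrite ltnn.
case/and3P: bs => ps /allP as_ sn; rewrite /bounded_overpartition ps sn andbT.
by apply/allP => p /as_ /and3P [-> h ->]; rewrite (leq_trans h).
Qed.

(** An overlined [K.+1] can only be the head: an earlier entry would be at least as large, hence
    equal to [K.+1], and the overlined one would not be the first. *)
Lemma overlined_rec K n s : ~~ (l %| K.+1) ->
  bounded_overpartition K.+1 n s =
  (bounded_overpartition K.+1 n s && not_overlined K.+1 s) || (K.+1 <= n) &&
    (if s is q :: t then (q == (K.+1, true)) &&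
       (bounded_overpartition K.+1 (n - K.+1) t && not_overlined K.+1 t) else false).
Proof.
move=> lK; case: s => [|q t]; first by rewrite andbF orbF andbT.
have [->|qK] := eqVneq q (K.+1, true).
  rewrite bounded_overpartition_cons /= lK leqnn /= /not_overlined inE eqxx andbF /=.
  congr (_ && _); have [bt|] := boolP (bounded_overpartition _ _ t); rewrite ?andbF //=.
  by rewrite (all_part_rel_max _ bt) andbT.
rewrite /= andbF orbF; case: (boolP (bounded_overpartition _ _ _)) => // bs.
apply/esym/negP => tK; have /and3P [_ qK1 _] := bounded_overpartition_mem bs (mem_head _ _).
move: tK; rewrite inE eq_sym (negPf qK) /= => tK.
case/and3P: bs => /= /andP [/allP /(_ _ tK) + _] _ _; rewrite /part_rel /=.
by rewrite eqn_leq qK1 andbN.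
Qed.

Lemma enum_not_overlinedP K fuel n : ~~ (l %| K.+1) -> n <= fuel ->
  (forall m, enumerates (enum_overpartition K m) (bounded_overpartition K m)) ->
  enumerates (enum_not_overlined (enum_overpartition K) K.+1 fuel n)
    (fun s => bounded_overpartition K.+1 n s && not_overlined K.+1 s).
Proof.
move=> lK + EP; elim: fuel n => [|fuel IH] n nf /=.
  rewrite cats0; apply: eq_enumerates (EP n) => s.
  by rewrite not_overlined_rec //; case: n nf => //=; rewrite orbF.
case: (ltnP K n) => Kn; last first.
  rewrite cats0; apply: eq_enumerates (EP n) => s.
  by rewrite not_overlined_rec // ltnNge Kn /= orbF.
have h : n - K.+1 <= fuel by lia.
apply: eq_enumerates (enumerates_cons (EP n) (IH _ h) _) => s.
  by rewrite not_overlined_rec // Kn.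
by move=> /bounded_overpartition_mem bs; apply/negP => /bs /=; rewrite ltnn.
Qed.

Lemma enum_overpartitionP K n :
  enumerates (enum_overpartition K n) (bounded_overpartition K n).
Proof.
elim: K n => [|K IH] n /=.
  case: n => [|n]; split=> // -[|p s]; rewrite ?inE // /bounded_overpartition /=;
    by case: p => -[|p1] p2; rewrite ?ltnn /= ?andbF.
case: ifPn => lK.
  apply: eq_enumerates (IH n) => s; rewrite /bounded_overpartition; congr [&& _, _ & _].
  apply: eq_all => p; rewrite [p.1 <= K.+1]leq_eqVlt ltnS.
  by case: eqP => //= ->; rewrite lK /= !andbF.
have hN m (mn : m <= n) := enum_not_overlinedP lK mn IH.
case: (ltnP K n) => Kn; last first.
  rewrite cats0; apply: eq_enumerates (hN n (leqnn n)) => s.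
  by rewrite [RHS]overlined_rec // ltnNge Kn /= orbF.
apply: eq_enumerates (enumerates_cons (hN n _) (hN _ _) _) => //; last 2 first.
- exact: leq_subr.
- by move=> s /andP [].
by move=> s; rewrite [RHS]overlined_rec // Kn.
Qed.

(** For [K] positive the recursion stops before sufficient fuel runs out, so the fuel can be
    normalised to the argument. What remains is the coefficient form of b = E + q^K b. *)
Lemma size_enum_not_overlined E K fuel n : n <= fuel ->  0 < K ->
  size (enum_not_overlined E K fuel n) =
  size (E n) + if K <= n then size (enum_not_overlined E K (n - K) (n - K)) else 0.
Proof.
move=> nf K0; have fuelE f m : m <= f ->
  enum_not_overlined E K f m = enum_not_overlined E K m m.
  elim/ltn_ind: m f => m IH [|f] mf /=; first by case: m mf {IH}.
  case: m IH mf => [|m] IH mf /=; first by rewrite [K <= 0]leqNgt K0.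
  case: ifP => // Km; congr (_ ++ map _ _); rewrite !(IH (m.+1 - K)) //; lia.
case: fuel nf => [|f] nf /=; rewrite size_cat.
  by case: n nf => // _; rewrite leqNgt K0.
by case: ifP => // Kn; rewrite size_map fuelE //; lia.
Qed.

Lemma Abar_size_enum K n : n <= K -> Abar l n = size (enum_overpartition K n).
Proof.
move=> nK; have [u m] := enum_overpartitionP K n; apply: Abar_enum => // s.
rewrite m is_overpartitionE /no_part_divisible /bounded_overpartition all_map.
case: (pairwise _ _) => //=; case: eqP => [sn|]; rewrite ?andbF ?andbT //=.
have le_n p : p \in s -> p.1 <= n.
  rewrite -sn; elim: s {sn m} => //= q s IH; rewrite inE => /orP[/eqP ->|/IH h].
    exact: leq_addr.
  exact: leq_trans h (leq_addl _ _).
rewrite -all_predI; apply: eq_in_all => p ps /=.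
by rewrite (leq_trans (le_n p ps)).
Qed.

End Enumeration.

(** * Sums of three and four squares modulo 5 *)

Local Arguments Z.add : simpl never.
Local Arguments Z.sub : simpl never.
Local Arguments Z.mul : simpl never.
Local Arguments Z.opp : simpl never.

Definition zrange (M : nat) : seq Z :=
  [seq (Z.of_nat i - Z.of_nat M)%Z | i <- iota 0 (M.*2.+1)].

Lemma mem_zrange M z : (z \in zrange M) = (Z.abs z <=? Z.of_nat M)%Z.
Proof.
apply/mapP/idP => [[i]|h]; first by rewrite mem_iota => h ->; lia.
by exists (Z.to_nat (z + Z.of_nat M)); rewrite ?mem_iota; lia.
Qed.

Lemma uniq_zrange M : uniq (zrange M).
Proof. by rewrite map_inj_uniq ?iota_uniq // => i j; lia. Qed.

Definition norm3 (x : Z * Z * Z) : Z := let: (a, b, c) := x in (a * a + b * b + c * c)%Z.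
Definition norm4 (x : Z * Z * Z * Z) : Z :=
  let: (a, b, c, d) := x in (a * a + b * b + c * c + d * d)%Z.

Definition box2 M := [seq (a, b) | a <- zrange M, b <- zrange M].
Definition box3 M := [seq (x, c) | x <- box2 M, c <- zrange M].
Definition box4 M := [seq (x, d) | x <- box3 M, d <- zrange M].

(** Once [n <= M] the box misses no solution. Keeping [M] separate allows different norms to be
    compared inside one box, which will come from a truncated theta series. *)
Definition sol3 M n := [seq x <- box3 M | norm3 x == Z.of_nat n].
Definition sol4 M n := [seq x <- box4 M | norm4 x == Z.of_nat n].

Lemma mem_allpairs_pair (S T : eqType) (s : seq S) (t : seq T) x y :
  ((x, y) \in [seq (a, b) | a <- s, b <- t]) = (x \in s) && (y \in t).
Proof.
apply/allpairsP/andP => [[[a b] [/= ? ? [-> ->]]] //|[xs yt]].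
by exists (x, y).
Qed.

Lemma uniq_allpairs_pair (S T : eqType) (s : seq S) (t : seq T) :
  uniq s -> uniq t -> uniq [seq (a, b) | a <- s, b <- t].
Proof. by move=> us ut; apply: allpairs_uniq => // -[a b] [c d]. Qed.

Lemma uniq_sol3 M n : uniq (sol3 M n).
Proof. by apply: filter_uniq; rewrite !uniq_allpairs_pair ?uniq_zrange. Qed.

Lemma uniq_sol4 M n : uniq (sol4 M n).
Proof. by apply: filter_uniq; rewrite !uniq_allpairs_pair ?uniq_zrange. Qed.

Lemma abs_le_of_square a b n : (0 <= b -> a * a + b = n -> Z.abs a <= n)%Z.
Proof. nia. Qed.

Lemma mem_sol3 M n x : n <= M -> (x \in sol3 M n) = (norm3 x == Z.of_nat n).
Proof.
move=> nM; rewrite mem_filter; case: eqP => //=; case: x => [[a b] c] /= h.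
rewrite !mem_allpairs_pair !mem_zrange.
have := @abs_le_of_square a (b * b + c * c) (Z.of_nat n).
have := @abs_le_of_square b (a * a + c * c) (Z.of_nat n).
have := @abs_le_of_square c (a * a + b * b) (Z.of_nat n).
by lia.
Qed.

Lemma mem_sol4 M n x : n <= M -> (x \in sol4 M n) = (norm4 x == Z.of_nat n).
Proof.
move=> nM; rewrite mem_filter; case: eqP => //=; case: x => [[[a b] c] d] /= h.
rewrite !mem_allpairs_pair !mem_zrange.
have := @abs_le_of_square a (b * b + c * c + d * d) (Z.of_nat n).
have := @abs_le_of_square b (a * a + c * c + d * d) (Z.of_nat n).
have := @abs_le_of_square c (a * a + b * b + d * d) (Z.of_nat n).
have := @abs_le_of_square d (a * a + b * b + c * c) (Z.of_nat n).
by lia.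
Qed.

Lemma count_similarity (V : eqType) (s t : seq V) (P : pred V) (T T' : V -> V) :
  uniq s -> uniq t -> (forall x, x \in s -> T x \in t /\ P (T x)) ->
  (forall x, T' (T x) = x) ->
  (forall y, y \in t -> P y -> T' y \in s /\ T (T' y) = y) ->
  count P t = size s.
Proof.
move=> us ut Ts TK T's; rewrite -size_filter -[RHS](size_map T).
apply: perm_size; apply: uniq_perm.
- exact: filter_uniq.
- by rewrite map_inj_uniq //; apply: can_inj TK.
move=> y; rewrite mem_filter; apply/andP/mapP => [[Py /T's [] // sy Ty]|[x /Ts [? ?] ->] //].
by exists (T' y).
Qed.

Lemma sum_count_exchange (U V : Type) (us : seq U) (t : seq V) (P : U -> pred V) :
  \sum_(y <- t) count (P^~ y) us = \sum_(u <- us) count (P u) t.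
Proof.
under eq_bigr do rewrite -sum1_count big_mkcond.
by rewrite exchange_big /=; apply: eq_bigr => u _; rewrite -sum1_count [RHS]big_mkcond.
Qed.

(** * Quaternions of norm 5 and the similarities they define *)

Definition dvd (m a : Z) : bool := (a mod m =? 0)%Z.

Lemma dvd_eq_mul m a k : m <> 0%Z -> a = (m * k)%Z -> dvd m a.
Proof. by move=> m0 ->; rewrite /dvd Z.mul_comm Z.mod_mul. Qed.

Lemma dvdE m a : m <> 0%Z -> dvd m a -> a = (m * (a / m))%Z.
Proof. by rewrite /dvd => m0 /Z.eqb_eq h; have := Z.div_mod a m m0; lia. Qed.

Definition opp3 (u : Z * Z * Z) : Z * Z * Z := let: (p, q, r) := u in (- p, - q, - r)%Z.

Definition dvd3 m (x : Z * Z * Z) : bool :=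
  let: (a, b, c) := x in [&& dvd m a, dvd m b & dvd m c].
Definition div3 (x : Z * Z * Z) m : Z * Z * Z :=
  let: (a, b, c) := x in (a / m, b / m, c / m)%Z.
Definition mod3 (x : Z * Z * Z) m : Z * Z * Z :=
  let: (a, b, c) := x in (a mod m, b mod m, c mod m)%Z.
Definition scale3 (m : Z) (x : Z * Z * Z) : Z * Z * Z :=
  let: (a, b, c) := x in (m * a, m * b, m * c)%Z.

Definition dvd4 m (x : Z * Z * Z * Z) : bool := let: (y, d) := x in dvd3 m y && dvd m d.
Definition div4 (x : Z * Z * Z * Z) m : Z * Z * Z * Z :=
  let: (y, d) := x in (div3 y m, d / m)%Z.
Definition mod4 (x : Z * Z * Z * Z) m : Z * Z * Z * Z :=
  let: (y, d) := x in (mod3 y m, d mod m)%Z.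
Definition scale4 (m : Z) (x : Z * Z * Z * Z) : Z * Z * Z * Z :=
  let: (y, d) := x in (scale3 m y, m * d)%Z.

(* Left multiplication by the quaternion 1 + pi + qj + rk. *)
Definition lmulq (u : Z * Z * Z) (x : Z * Z * Z * Z) : Z * Z * Z * Z :=
  let: (p, q, r) := u in let: (a, b, c, d) := x in
  (a - p * b - q * c - r * d, b + p * a + q * d - r * c,
   c + q * a + r * b - p * d, d + r * a + p * c - q * b)%Z.

(* The map x |-> (1 + u) x (1 - u) on purely imaginary quaternions. *)
Definition conjq (u : Z * Z * Z) (x : Z * Z * Z) : Z * Z * Z :=
  let: (p, q, r) := u in let: (a, b, c) := x in
  let s := (1 - (p * p + q * q + r * r))%Z in
  let t := (2 * (p * a + q * b + r * c))%Z in
  (s * a + 2 * (q * c - r * b) + t * p, s * b + 2 * (r * a - p * c) + t * q,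
   s * c + 2 * (p * b - q * a) + t * r)%Z.

(* 1 + u, for u in imag5, represents each quaternion of norm 5 in Z<1,i,j,k> once
   up to right multiplication by a unit. *)
Definition imag5 : seq (Z * Z * Z) :=
  [:: (2, 0, 0); (-2, 0, 0); (0, 2, 0); (0, -2, 0); (0, 0, 2); (0, 0, -2)]%Z.

Lemma norm_imag5 u : u \in imag5 -> norm3 u = 4%Z.
Proof. by rewrite !inE => /orP[/eqP->|/orP[/eqP->|/orP[/eqP->|/orP[/eqP->|/orP[/eqP->|/eqP->]]]]]. Qed.

Lemma norm_opp3 u : norm3 (opp3 u) = norm3 u.
Proof. by case: u => [[p q] r] /=; ring. Qed.

Lemma opp3K u : opp3 (opp3 u) = u.
Proof. by case: u => [[p q] r] /=; rewrite !Z.opp_involutive. Qed.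

Lemma norm_lmulq u x : norm4 (lmulq u x) = ((1 + norm3 u) * norm4 x)%Z.
Proof. by case: u x => [[p q] r] [[[a b] c] d] /=; ring. Qed.

(** The conjugate of 1 + u is 1 - u, and (1 - u)(1 + u) is the scalar 1 + |u|^2, equal to 5 on
    [imag5]. *)
Lemma lmulq_opp u x : lmulq (opp3 u) (lmulq u x) = scale4 (1 + norm3 u) x.
Proof. by case: u x => [[p q] r] [[[a b] c] d] /=; congr (_, _, _, _); ring. Qed.

Lemma lmulq_scale u m x : lmulq u (scale4 m x) = scale4 m (lmulq u x).
Proof. by case: u x => [[p q] r] [[[a b] c] d] /=; congr (_, _, _, _); ring. Qed.

Lemma norm_conjq u x : norm3 (conjq u x) = ((1 + norm3 u) * (1 + norm3 u) * norm3 x)%Z.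
Proof. by case: u x => [[p q] r] [[a b] c] /=; ring. Qed.

Lemma conjq_opp u x :
  conjq (opp3 u) (conjq u x) = scale3 ((1 + norm3 u) * (1 + norm3 u)) x.
Proof. by case: u x => [[p q] r] [[a b] c] /=; congr (_, _, _); ring. Qed.

Lemma conjq_scale u m x : conjq u (scale3 m x) = scale3 m (conjq u x).
Proof. by case: u x => [[p q] r] [[a b] c] /=; congr (_, _, _); ring. Qed.

Lemma scale3_div m x : m <> 0%Z -> dvd3 m x -> scale3 m (div3 x m) = x.
Proof.
case: x => [[a b] c] m0 /= /and3P[da db dc].
by rewrite -!dvdE.
Qed.

Lemma div3_scale m x : m <> 0%Z -> div3 (scale3 m x) m = x.
Proof. by case: x => [[a b] c] m0 /=; rewrite ![(m * _)%Z]Z.mul_comm !Z.div_mul. Qed.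

Lemma dvd3_scale m x : m <> 0%Z -> dvd3 m (scale3 m x).
Proof.
by case: x => [[a b] c] m0 /=; rewrite /dvd ![(m * _)%Z]Z.mul_comm !Z.mod_mul ?Z.eqb_refl.
Qed.

Lemma scale4_div m x : m <> 0%Z -> dvd4 m x -> scale4 m (div4 x m) = x.
Proof. by case: x => [y d] m0 /= /andP[dy dd]; rewrite scale3_div // -dvdE. Qed.

Lemma div4_scale m x : m <> 0%Z -> div4 (scale4 m x) m = x.
Proof. by case: x => [y d] m0 /=; rewrite div3_scale // Z.mul_comm Z.div_mul. Qed.

Lemma dvd4_scale m x : m <> 0%Z -> dvd4 m (scale4 m x).
Proof. by case: x => [y d] m0 /=; rewrite dvd3_scale // /dvd Z.mul_comm Z.mod_mul. Qed.

Lemma norm3_scale m x : norm3 (scale3 m x) = (m * m * norm3 x)%Z.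
Proof. by case: x => [[a b] c] /=; ring. Qed.

Lemma norm4_scale m x : norm4 (scale4 m x) = (m * m * norm4 x)%Z.
Proof. by case: x => [[[a b] c] d] /=; ring. Qed.

Lemma scale3_inj m x y : m <> 0%Z -> scale3 m x = scale3 m y -> x = y.
Proof. by move=> m0 h; rewrite -(div3_scale x m0) h div3_scale. Qed.

Lemma scale4_inj m x y : m <> 0%Z -> scale4 m x = scale4 m y -> x = y.
Proof. by move=> m0 h; rewrite -(div4_scale x m0) h div4_scale. Qed.

(** A vector y lies in (1 + u) Z^4 exactly when 5 divides (1 - u) y, the preimage then being the
    quotient. So multiplication by 1 + u matches the vectors of norm n with the counted ones. *)
Lemma count_lmulq M n u : u \in imag5 -> 5 * n <= M ->
  count (fun y => dvd4 5 (lmulq (opp3 u) y)) (sol4 M (5 * n)) = size (sol4 M n).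
Proof.
move=> uU nM; have nM' : n <= M by lia.
have nu := norm_imag5 uU.
apply: (@count_similarity _ _ _ _ (lmulq u) (fun y => div4 (lmulq (opp3 u) y) 5)).
- exact: uniq_sol4.
- exact: uniq_sol4.
- move=> x; rewrite !mem_sol4 // norm_lmulq nu lmulq_opp nu => /eqP ->.
  by rewrite dvd4_scale //; split=> //; lia.
- by move=> x; rewrite lmulq_opp nu div4_scale.
move=> y; rewrite !mem_sol4 // => /eqP ny dy.
have yE : scale4 5 (div4 (lmulq (opp3 u) y) 5) = lmulq (opp3 u) y by rewrite scale4_div.
split.
  have := norm4_scale 5 (div4 (lmulq (opp3 u) y) 5).
  rewrite yE norm_lmulq norm_opp3 nu ny; lia.
apply: (@scale4_inj 5) => //; rewrite -lmulq_scale yE.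
by have := lmulq_opp (opp3 u) y; rewrite opp3K norm_opp3 nu.
Qed.

(** The same argument for x |-> (1 + u) x (1 - u), which multiplies norms by 25 and is inverted by
    the map of -u up to the factor 25. *)
Lemma count_conjq M n u : u \in imag5 -> 25 * n <= M ->
  count (fun y => dvd3 25 (conjq (opp3 u) y)) (sol3 M (25 * n)) = size (sol3 M n).
Proof.
move=> uU nM; have nM' : n <= M by lia.
have nu := norm_imag5 uU.
apply: (@count_similarity _ _ _ _ (conjq u) (fun y => div3 (conjq (opp3 u) y) 25)).
- exact: uniq_sol3.
- exact: uniq_sol3.
- move=> x; rewrite !mem_sol3 // norm_conjq nu conjq_opp nu => /eqP ->.
  by rewrite dvd3_scale //; split=> //; lia.
- by move=> x; rewrite conjq_opp nu div3_scale.
move=> y; rewrite !mem_sol3 // => /eqP ny dy.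
have yE : scale3 25 (div3 (conjq (opp3 u) y) 25) = conjq (opp3 u) y by rewrite scale3_div.
split.
  have := norm3_scale 25 (div3 (conjq (opp3 u) y) 25).
  rewrite yE norm_conjq norm_opp3 nu ny; lia.
apply: (@scale3_inj 25) => //; rewrite -conjq_scale yE.
by have := conjq_opp (opp3 u) y; rewrite opp3K norm_opp3 nu.
Qed.

Lemma count_dvd3 M n : 25 * n <= M ->
  count (dvd3 5) (sol3 M (25 * n)) = size (sol3 M n).
Proof.
move=> nM; have nM' : n <= M by lia.
apply: (@count_similarity _ _ _ _ (scale3 5) (div3^~ 5%Z)).
- exact: uniq_sol3.
- exact: uniq_sol3.
- move=> x; rewrite !mem_sol3 // norm3_scale => /eqP ->.
  by rewrite dvd3_scale //; split=> //; lia.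
- by move=> x; rewrite div3_scale.
move=> y; rewrite !mem_sol3 // => /eqP ny dy.
have yE : scale3 5 (div3 y 5) = y by rewrite scale3_div.
split=> //; have := norm3_scale 5 (div3 y 5); rewrite yE ny; lia.
Qed.

(** * Finite computations modulo 5 and 25 *)

Definition residues (m : nat) : seq Z := map Z.of_nat (iota 0 m).

Lemma mod_residues m a : 0 < m -> (a mod Z.of_nat m)%Z \in residues m.
Proof.
move=> m0; have := Z.mod_pos_bound a (Z.of_nat m).
by move=> h; apply/mapP; exists (Z.to_nat (a mod Z.of_nat m)); rewrite ?mem_iota; lia.
Qed.

Definition check4 (x : Z * Z * Z * Z) : bool :=
  dvd 5 (norm4 x) ==>
  (count (fun u => dvd4 5 (lmulq (opp3 u) x)) imag5 %% 5 == 1).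

(** Modulo 5 the quaternions form the 2 by 2 matrices over F_5, with the norm as determinant, and
    the images of the six 1 + u are the six lines of F_5^2. The count is that of the lines
    containing the image of x: one if x has rank 1, six if x = 0, hence always 1 modulo 5. *)
Lemma check4_residues :
  all (fun a => all (fun b => all (fun c => all (fun d => check4 (a, b, c, d))
    (residues 5)) (residues 5)) (residues 5)) (residues 5).
Proof. by vm_compute. Qed.

(* The condition modulo 125 on a multiple x = 5z of 5 says that norm3 z is 0,
   respectively 1 or 4, modulo 5. *)
Definition check3 (x : Z * Z * Z) : bool :=
  dvd 25 (norm3 x) ==>
  let k := count (fun u => dvd3 25 (conjq (opp3 u) x)) imag5 in
  if dvd3 5 x then
    (dvd 125 (norm3 x) ==> (k %% 5 == 1)) &&
    ((dvd 125 (norm3 x - 25) || dvd 125 (norm3 x - 100)) ==> (k == 2))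
  else k == 1.

(** For x = 5z the condition reads (1 - u) z (1 + u) = 0 modulo 5, so the count is that of the
    eigenlines of z over F_5. As z^2 = -|z|^2 and -1 is a square modulo 5, there are two when |z|^2
    is 1 or 4; when it is 0 there is one, or six if z = 0. *)
Lemma check3_residues :
  all (fun a => all (fun b => all (fun c => check3 (a, b, c))
    (residues 25)) (residues 25)) (residues 25).
Proof. by vm_compute. Qed.

Definition add3 (x y : Z * Z * Z) : Z * Z * Z :=
  let: (a, b, c) := x in let: (a', b', c') := y in (a + a', b + b', c + c')%Z.
Definition add4 (x y : Z * Z * Z * Z) : Z * Z * Z * Z :=
  let: (a, b) := x in let: (a', b') := y in (add3 a a', b + b')%Z.

Lemma mod3_shift m x : m <> 0%Z -> x = add3 (mod3 x m) (scale3 m (div3 x m)).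
Proof.
move=> m0; have h z := Z.div_mod z m m0.
by case: x => [[a b] c] /=; congr (_, _, _); rewrite Z.add_comm -h.
Qed.

Lemma mod4_shift m x : m <> 0%Z -> x = add4 (mod4 x m) (scale4 m (div4 x m)).
Proof.
move=> m0; have h z := Z.div_mod z m m0.
by case: x => [x d] /=; rewrite -mod3_shift // Z.add_comm -h.
Qed.

Lemma dvd_add_mul m a b : m <> 0%Z -> dvd m (a + m * b) = dvd m a.
Proof. by move=> m0; rewrite /dvd Z.mul_comm Z.mod_add. Qed.

Lemma dvd3_add_scale m x y : m <> 0%Z -> dvd3 m (add3 x (scale3 m y)) = dvd3 m x.
Proof. by case: x y => [[a b] c] [[a' b'] c'] m0 /=; rewrite !dvd_add_mul. Qed.

Lemma dvd4_add_scale m x y : m <> 0%Z -> dvd4 m (add4 x (scale4 m y)) = dvd4 m x.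
Proof. by case: x y => [x a] [y b] m0 /=; rewrite dvd3_add_scale // dvd_add_mul. Qed.

Lemma lmulq_add u x y : lmulq u (add4 x y) = add4 (lmulq u x) (lmulq u y).
Proof.
by case: u x y => [[p q] r] [[[a b] c] d] [[[a' b'] c'] d'] /=; congr (_, _, _, _); ring.
Qed.

Lemma conjq_add u x y : conjq u (add3 x y) = add3 (conjq u x) (conjq u y).
Proof. by case: u x y => [[p q] r] [[a b] c] [[a' b'] c'] /=; congr (_, _, _); ring. Qed.

Definition dot3 (x y : Z * Z * Z) : Z :=
  let: (a, b, c) := x in let: (a', b', c') := y in (a * a' + b * b' + c * c')%Z.

Lemma norm3_add x y : norm3 (add3 x y) = (norm3 x + 2 * dot3 x y + norm3 y)%Z.
Proof. by case: x y => [[a b] c] [[a' b'] c'] /=; ring. Qed.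

Lemma norm4_add_scale m x y : exists k, norm4 (add4 x (scale4 m y)) = (norm4 x + m * k)%Z.
Proof.
case: x y => [[[a b] c] d] [[[a' b'] c'] d'] /=.
by exists (2 * (a * a' + b * b' + c * c' + d * d') +
  m * (a' * a' + b' * b' + c' * c' + d' * d'))%Z; ring.
Qed.

Lemma dot3_scalel k x y : dot3 (scale3 k x) y = (k * dot3 x y)%Z.
Proof. by case: x y => [[a b] c] [[a' b'] c'] /=; ring. Qed.

Lemma dot3_scaler k x y : dot3 x (scale3 k y) = (k * dot3 x y)%Z.
Proof. by case: x y => [[a b] c] [[a' b'] c'] /=; ring. Qed.

Lemma check4P x : check4 x.
Proof.
have e : x = add4 (mod4 x 5) (scale4 5 (div4 x 5)) by apply: mod4_shift.
 have /allP h := check4_residues.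
have -> : check4 x = check4 (mod4 x 5).
  have [k ek] := norm4_add_scale 5 (mod4 x 5) (div4 x 5).
  rewrite /check4 {1 2}e ek dvd_add_mul //; congr (_ ==> (_ %% 5 == 1)).
  by apply: eq_count => u; rewrite e lmulq_add lmulq_scale dvd4_add_scale -?e.
case: x {e} => [[[a b] c] d] /=.
move: (h _ (@mod_residues 5 a isT)) => /allP /(_ _ (@mod_residues 5 b isT)).
by move=> /allP /(_ _ (@mod_residues 5 c isT)) /allP /(_ _ (@mod_residues 5 d isT)).
Qed.

Lemma check3P x : check3 x.
Proof.
have e : x = add3 (mod3 x 25) (scale3 25 (div3 x 25)) by apply: mod3_shift.
 have /allP h := check3_residues.
have -> : check3 x = check3 (mod3 x 25).
  set y := mod3 x 25 in e *; set z := div3 x 25 in e.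
  have ny : norm3 x = (norm3 y + 25 * (2 * dot3 y z + 25 * norm3 z))%Z.
    by rewrite {1}e norm3_add norm3_scale dot3_scaler; ring.
  have d25 : dvd 25 (norm3 x) = dvd 25 (norm3 y) by rewrite ny dvd_add_mul.
  have d5 : dvd3 5 x = dvd3 5 y.
    have -> : x = add3 y (scale3 5 (scale3 5 z)).
      by rewrite {1}e; case: (z) => [[a b] c] /=; rewrite !Z.mul_assoc.
    exact: dvd3_add_scale.
  have ek : count (fun u => dvd3 25 (conjq (opp3 u) x)) imag5 =
            count (fun u => dvd3 25 (conjq (opp3 u) y)) imag5.
    by apply: eq_count => u; rewrite e conjq_add conjq_scale dvd3_add_scale.
  rewrite /check3 d25 ek d5; case: (boolP (dvd3 5 y)) => [dy|//].
  (* Residues modulo 25 determine the norm modulo 125 here: y is divisible by 5, so the cross term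
     50 y.z is a multiple of 250. *)
  have e125 : norm3 x = (norm3 y + 125 * (2 * dot3 (div3 y 5) z + 5 * norm3 z))%Z.
    rewrite ny; have {2}-> : y = scale3 5 (div3 y 5) by rewrite scale3_div.
    by rewrite dot3_scalel; ring.
  have d125 c : dvd 125 (norm3 x - c) = dvd 125 (norm3 y - c).
    rewrite -[RHS](@dvd_add_mul 125 _ (2 * dot3 (div3 y 5) z + 5 * norm3 z)) //.
    by congr dvd; rewrite e125; ring.
  by rewrite !d125 -[norm3 x]Z.sub_0_r d125 Z.sub_0_r.
case: x {e} => [[a b] c] /=.
move: (h _ (@mod_residues 25 a isT)) => /allP /(_ _ (@mod_residues 25 b isT)).
by move=> /allP /(_ _ (@mod_residues 25 c isT)).
Qed.

(** * Recurrences for the numbers of sums of three and four squares *)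

Lemma sum_seq_const (U : Type) (us : seq U) k : \sum_(u <- us) k = size us * k.
Proof. by rewrite big_const_seq count_predT iter_addn_0 mulnC. Qed.

Lemma sum_seq_mod (V : eqType) (t : seq V) (F : V -> nat) m :
  (forall y, y \in t -> F y = 1 %[mod m]) -> \sum_(y <- t) F y = size t %[mod m].
Proof.
elim: t => [|y t IH] h; first by rewrite big_nil.
rewrite big_cons /= -modnDm h ?mem_head // IH ?modnDm ?add1n // => z zt.
by apply: h; rewrite inE zt orbT.
Qed.

Lemma sum_count_lmulq M n : 5 * n <= M ->
  \sum_(y <- sol4 M (5 * n)) count (fun u => dvd4 5 (lmulq (opp3 u) y)) imag5 =
  6 * size (sol4 M n).
Proof.
move=> nM; rewrite (sum_count_exchange imag5 _ (fun u y => dvd4 5 (lmulq (opp3 u) y))).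
rewrite big_seq (eq_bigr (fun=> size (sol4 M n))) => [|u uU]; last exact: count_lmulq.
by rewrite -big_seq sum_seq_const.
Qed.

(** Each y of norm 5n is counted 1 modulo 5 times, and the total is 6 r_4(n), with 6 = 1 modulo
    5. *)
Lemma size_sol4_mul5 M n : 5 * n <= M -> size (sol4 M (5 * n)) = size (sol4 M n) %[mod 5].
Proof.
move=> nM; have h := sum_count_lmulq nM.
rewrite -(@sum_seq_mod _ _ (fun y => count (fun u => dvd4 5 (lmulq (opp3 u) y)) imag5)).
  by rewrite h -modnMml mul1n.
move=> y; rewrite mem_sol4 // => /eqP ny; have := check4P y.
rewrite /check4 ny => /implyP h4; apply/eqP/h4.
by rewrite /dvd Nat2Z.inj_mul Z.mul_comm Z.mod_mul.
Qed.

Lemma sum_count_conjq M n : 25 * n <= M ->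
  \sum_(y <- sol3 M (25 * n)) count (fun u => dvd3 25 (conjq (opp3 u) y)) imag5 =
  6 * size (sol3 M n).
Proof.
move=> nM; rewrite (sum_count_exchange imag5 _ (fun u y => dvd3 25 (conjq (opp3 u) y))).
rewrite big_seq (eq_bigr (fun=> size (sol3 M n))) => [|u uU]; last exact: count_conjq.
by rewrite -big_seq sum_seq_const.
Qed.

Lemma size_sol3_mul25_dvd M n : 25 * n <= M -> 5 %| n ->
  size (sol3 M (25 * n)) = size (sol3 M n) %[mod 5].
Proof.
move=> nM /dvdnP [m nE]; have := sum_count_conjq nM => h.
rewrite -(@sum_seq_mod _ _ (fun y => count (fun u => dvd3 25 (conjq (opp3 u) y)) imag5)).
  by rewrite h -modnMml mul1n.
move=> y; rewrite mem_sol3 // => /eqP ny; have := check3P y.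
have d25 : dvd 25 (norm3 y) by apply: (@dvd_eq_mul _ _ (Z.of_nat n)); lia.
have d125 : dvd 125 (norm3 y) by apply: (@dvd_eq_mul _ _ (Z.of_nat m)); lia.
rewrite /check3 d25 d125 /=; case: ifP => _; first by case/andP => /eqP.
by move/eqP ->.
Qed.

(** Each y of norm 25n is counted once, and once more if 5 divides it. The multiples of 5 number
    r_3(n), so r_3(25n) + r_3(n) = 6 r_3(n). *)
Lemma size_sol3_mul25_unit M n : 25 * n <= M -> (n %% 5 == 1) || (n %% 5 == 4) ->
  size (sol3 M (25 * n)) = 5 * size (sol3 M n).
Proof.
move=> nM n5; have := sum_count_conjq nM.
rewrite big_seq (eq_bigr (fun y => 1 + (dvd3 5 y : nat))) => [|y].
  rewrite -big_seq big_split /= sum_seq_const -[X in _ + X]big_mkcond sum1_count count_dvd3 //.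
  lia.
rewrite mem_sol3 // => /eqP ny; have := check3P y.
have d25 : dvd 25 (norm3 y) by apply: (@dvd_eq_mul _ _ (Z.of_nat n)); lia.
have d125 : dvd 125 (norm3 y - 25) || dvd 125 (norm3 y - 100).
  by case/orP: n5 => n5; apply/orP; [left|right];
    apply: (@dvd_eq_mul _ _ (Z.of_nat (n %/ 5))); lia.
rewrite /check3 d25 d125 /=; case: ifP => _; last by move/eqP ->.
by case/andP => _ /eqP.
Qed.

(** The first factor 25 produces the divisibility by 5. Every further one multiplies an argument
    already divisible by 5 and so preserves the count modulo 5. *)
Lemma size_sol3_25pow M j n : 25 ^ j.+1 * n <= M -> (n %% 5 == 1) || (n %% 5 == 4) ->
  5 %| size (sol3 M (25 ^ j.+1 * n)).
Proof.
elim: j => [|j IH] nM n5.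
  by rewrite expn1 size_sol3_mul25_unit // dvdn_mulr.
rewrite expnS -mulnA in nM *; rewrite /dvdn size_sol3_mul25_dvd //.
  by apply: IH => //; lia.
by rewrite expnS -mulnA dvdn_mulr.
Qed.

Local Open Scope ring_scope.

(** * Gauss's identity *)

Section PolyModXn.
Variable R : comNzRingType.
Implicit Types (p q r d : {poly R}) (N : nat).

(** Congruence modulo X^N lets polynomials stand in for power series throughout. *)
Definition eqX N p q := exists r, p = q + 'X^N * r.

Lemma eqX_refl N p : eqX N p p.
Proof. by exists 0; rewrite mulr0 addr0. Qed.

Lemma eqX_sym N p q : eqX N p q -> eqX N q p.
Proof. by case=> r ->; exists (- r); ring. Qed.

Lemma eqX_trans N p q r : eqX N p q -> eqX N q r -> eqX N p r.
Proof. by case=> a -> [b ->]; exists (a + b); ring. Qed.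

Lemma eqXM N p p' q q' : eqX N p p' -> eqX N q q' -> eqX N (p * q) (p' * q').
Proof.
by case=> a -> [b ->]; exists (a * q' + p' * b + 'X^N * a * b); ring.
Qed.

Lemma eqXMr N r p q : eqX N p q -> eqX N (p * r) (q * r).
Proof. by move=> h; apply: eqXM h (eqX_refl _ _). Qed.

Lemma eqX_weak N M p q : (M <= N)%N -> eqX N p q -> eqX M p q.
Proof.
by move=> MN [r ->]; exists ('X^(N - M) * r); rewrite mulrA -exprD subnKC.
Qed.

Lemma eqX_coef N p q : eqX N p q <-> forall i, (i < N)%N -> p`_i = q`_i.
Proof.
split=> [[r ->] i iN|h]; first by rewrite coefD coefXnM iN addr0.
exists (drop_poly N (p - q)); rewrite -[LHS](subrK q) addrC; congr (_ + _).
rewrite -[LHS](poly_take_drop N) mulrC.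
suff -> : take_poly N (p - q) = 0 by rewrite add0r.
by apply/polyP => i; rewrite coef_take_poly coef0; case: ifP => // /h; rewrite coefB => ->; rewrite subrr.
Qed.

Lemma eqX_comp_Xn N l p q : (0 < l)%N -> eqX N p q -> eqX N (p \Po 'X^l) (q \Po 'X^l).
Proof.
move=> l0 [r ->]; apply: (@eqX_weak (l * N)); first by rewrite leq_pmull.
exists (r \Po 'X^l).
by rewrite comp_polyD comp_polyM comp_Xn_poly exprM.
Qed.

Lemma eqX_cancel N d p q : d`_0 = 1 -> eqX N (p * d) (q * d) -> eqX N p q.
Proof.
move=> d0 h.
pose e := drop_poly 1 (1 - d).
have dE : d = 1 - 'X * e.
  have := poly_take_drop 1 (1 - d).
  have -> : take_poly 1 (1 - d) = 0.
    apply/polyP => i; rewrite coef_take_poly coef0 coefB coef1.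
    by case: i => //=; rewrite d0 subrr.
  by rewrite add0r expr1 mulrC -/e => ->; ring.
(* The truncated geometric series inverts d = 1 - X e modulo X^N. *)
pose g := \sum_(i < N) ('X * e) ^+ i.
have gd : d * g = 1 - 'X^N * e ^+ N.
  have := subrX1 ('X * e) N; rewrite exprMn => gE.
  by rewrite dE -[RHS]opprB gE /g; ring.
have k r : eqX N (r * d * g) r by exists (- (r * e ^+ N)); rewrite -mulrA gd; ring.
apply: eqX_trans (eqX_trans (eqXMr g h) (k q)).
exact: eqX_sym.
Qed.

End PolyModXn.

Section Gauss.
Variable R : comNzRingType.
Local Notation T := {poly R}.

Definition prodP n : T := \prod_(k < n) (1 + 'X^(k.+1)).
Definition prodM n : T := \prod_(k < n) (1 - 'X^(k.+1)).

(** The part |k| <= n of the theta series phi, with the terms of k and -k merged. *)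
Definition alt_theta n : T := 1 + \sum_(k < n) 2%:R * (-1) ^+ k.+1 * 'X^(k.+1 ^ 2).

(* Shanks's finite form of Gauss's identity, multiplied by prodP n to stay within
   polynomials: the terms with s > 0 are divisible by X^(n+1). *)
Definition shanks s n : T :=
  if s is s'.+1 then
    2%:R * (-1) ^+ s * 'X^(s * n.+1) * prodP s' * \prod_(s <= k < n) (1 - 'X^(k.+1))
  else prodM n.

(** The right side is the boundary term of a telescoping sum over s. For m = n its last product is
    empty, leaving -2 (-1)^n X^((n+1)^2) [prodP n]. *)
Lemma shanks_telescope n m : (m <= n)%N ->
  \sum_(s < m.+1) (shanks s n.+1 - (1 + 'X^(n.+1)) * shanks s n) =
  - (2%:R * (-1) ^+ m * 'X^(m.+1 * n.+1) * prodP m * \prod_(m <= k < n) (1 - 'X^(k.+1))).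
Proof.
elim: m => [_|m IH mn].
  rewrite big_ord1 /shanks /prodM /prodP big_ord_recr /= big_ord0 big_mkord mul1n expr0.
  by move: (\prod_(i < n) _) => a; ring.
rewrite big_ord_recr /= IH; last exact: ltnW.
rewrite (big_ltn mn) (big_nat_recr n) //=.
rewrite /prodP big_ord_recr /=.
move: (\prod_(i < m) _) (\prod_(_ <= i < n) _) => a b.
have -> : (m.+1 * n.+2 = m.+1 * n.+1 + m.+1)%N by lia.
have -> : (m.+2 * n.+1 = m.+1 * n.+1 + n.+1)%N by lia.
rewrite !exprD !exprS.
ring.
Qed.

Lemma prodP_alt_theta n : prodP n * alt_theta n = \sum_(s < n.+1) shanks s n.
Proof.
elim: n => [|n IH].
  by rewrite big_ord1 /= /prodP /prodM /alt_theta !big_ord0 addr0 mulr1.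
rewrite /alt_theta big_ord_recr addrA -/(alt_theta n) /= {1}/prodP big_ord_recr /= -/(prodP n).
have -> : \sum_(s < n.+2) shanks s n.+1 =
  (1 + 'X^(n.+1)) * \sum_(s < n.+1) shanks s n +
  (\sum_(s < n.+1) (shanks s n.+1 - (1 + 'X^(n.+1)) * shanks s n) + shanks n.+1 n.+1).
  by rewrite big_ord_recr /= sumrB -mulr_sumr; ring.
rewrite -IH shanks_telescope //= !big_geq // !mulr1.
(* The boundary term and the last Shanks term have exponents (n+1)^2 and (n+1)^2 + (n+1). Together
   they carry the factor 1 + X^(n+1) and give the new theta term times [prodP n.+1]. *)
have -> : (n.+1 * n.+2 = n.+1 ^ 2 + n.+1)%N by lia.
have -> : (n.+1 * n.+1 = n.+1 ^ 2)%N by lia.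
by rewrite !exprD [(-1) ^+ n.+1]exprS; ring.
Qed.

Lemma gauss n : eqX n.+1 (alt_theta n * prodP n) (prodM n).
Proof.
rewrite mulrC prodP_alt_theta big_ord_recl /=.
exists (\sum_(i < n) 2%:R * (-1) ^+ i.+1 * 'X^(i * n.+1) * prodP i *
   \prod_(i.+1 <= k < n) (1 - 'X^(k.+1))).
congr (_ + _); rewrite mulr_sumr; apply: eq_bigr => i _ /=.
rewrite mulSn exprD; ring.
Qed.

Lemma prodP0 n : (prodP n)`_0 = 1.
Proof.
elim: n => [|n IH]; first by rewrite /prodP big_ord0 coef1.
by rewrite /prodP big_ord_recr coef0M -/(prodP n) IH coefD coef1 coefXn /= addr0 mulr1.
Qed.

End Gauss.

(** * Generating functions *)

Section GeneratingFunction.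
Variables (R : comNzRingType) (l : nat).

Definition gf_poly N (a : nat -> nat) : {poly R} := \poly_(i < N) (a i)%:R.

Definition prod_coprime (F : nat -> {poly R}) K :=
  \prod_(k < K) (if (l %| k.+1)%N then 1 else F k.+1).

Lemma prod_coprimeS F K :
  prod_coprime F K.+1 = prod_coprime F K * (if (l %| K.+1)%N then 1 else F K.+1).
Proof. exact: big_ord_recr. Qed.

Lemma gf_enum_overpartition K N :
  eqX N (gf_poly N (fun n => size (enum_overpartition l K n)) *
         prod_coprime (fun k => 1 - 'X^k) K)
    (prod_coprime (fun k => 1 + 'X^k) K).
Proof.
elim: K => [|K IH].
  rewrite /prod_coprime !big_ord0 mulr1; apply/eqX_coef => i iN.
  by rewrite coef_poly iN coef1; case: i iN.
rewrite !prod_coprimeS /=.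
case: ifPn => lK; first by rewrite !mulr1.
(* The two stages of the enumeration become b (1 - X^(K+1)) = A and A' = b (1 + X^(K+1)), modulo
   X^N. *)
pose b n := size (enum_not_overlined (enum_overpartition l K) K.+1 n n).
set A := gf_poly _ _ in IH; set A' := gf_poly _ _.
have bE n : (n < N)%N -> (gf_poly N b)`_n = A`_n + (gf_poly N b * 'X^(K.+1))`_n.
  move=> nN; rewrite coefMXn !coef_poly nN {1}/b size_enum_not_overlined // natrD.
  congr (_ + _); rewrite [(n < K.+1)%N]ltnNge; case: ifP => //= _.
  by rewrite ifT //; apply: leq_ltn_trans nN; apply: leq_subr.
have AB : eqX N (gf_poly N b * (1 - 'X^(K.+1))) A.
  by apply/eqX_coef => n /bE; rewrite mulrBr mulr1 coefB => ->; rewrite addrK.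
have A'B : eqX N A' (gf_poly N b * (1 + 'X^(K.+1))).
  apply/eqX_coef => n nN; rewrite mulrDr mulr1 coefD coefMXn !coef_poly nN.
  rewrite size_cat natrD; congr (_ + _).
  rewrite [(n < K.+1)%N]ltnNge; case: ifP => //= Kn.
  rewrite size_map ifT; last by apply: leq_ltn_trans nN; apply: leq_subr.
  rewrite /b; congr _%:R.
  by rewrite [LHS]size_enum_not_overlined ?leq_subr // [RHS]size_enum_not_overlined.
apply: eqX_trans (eqXMr _ A'B) _.
apply: eqX_trans (eqXMr (1 + 'X^(K.+1)) IH).
rewrite [X in eqX _ _ X](_ : _ = A * (prod_coprime (fun k => 1 - 'X^k) K * (1 + 'X^(K.+1)))); last by ring.
rewrite [X in eqX _ X _](_ : _ = (gf_poly N b * (1 - 'X^(K.+1))) *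
   (prod_coprime (fun k => 1 - 'X^k) K * (1 + 'X^(K.+1)))); last by ring.
exact: eqXMr.
Qed.

Lemma prod_coprime_mul (F : nat -> {poly R}) M : (0 < l)%N ->
  \prod_(k < l * M) F k.+1 = prod_coprime F (l * M) * \prod_(k < M) F (l * k.+1)%N.
Proof.
move=> l0; have -> : \prod_(k < M) F (l * k.+1)%N =
    \prod_(k < l * M) (if (l %| k.+1)%N then F k.+1 else 1).
  elim: M => [|M IH]; first by rewrite muln0 !big_ord0.
  rewrite big_ord_recr /= IH -!(big_mkord xpredT (fun k => if (l %| k.+1)%N then F k.+1 else 1)).
  rewrite [in RHS](@big_cat_nat _ _ _ (l * M)) //=; last by rewrite leq_mul2l leqnSn orbT.
  congr (_ * _); rewrite mulnS addnC; case: l l0 => // l' _.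
  rewrite addnS big_nat_recr ?leq_addr //= big_nat big1 ?mul1r.
    by rewrite -addnS -[X in (_ + X)%N]muln1 -mulnDr dvdn_mulr // addn1.
  move=> k /andP [k1 k2]; case: ifP => // /dvdnP [c kc].
  by case: (leqP c M) => h; have := leq_mul h (leqnn l'.+1); lia.
rewrite /prod_coprime -big_split; apply: eq_bigr => k _ /=.
by case: ifP; rewrite ?mul1r ?mulr1.
Qed.

(** The factors of the Gauss products up to l M whose index is a multiple of l form the Gauss
    products up to M in X^l; the others are those of the generating function. Applying Gauss's
    identity to both, and cancelling [prodP R (l * M)] with constant term 1, gives A(q) phi(q) =
    phi(q^l). *)
Lemma Abar_theta M : (0 < l)%N ->
  eqX M.+1 (gf_poly M.+1 (Abar l) * alt_theta R (l * M)) (alt_theta R M \Po 'X^l).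
Proof.
move=> l0.
have Ml : (M <= l * M)%N by rewrite leq_pmull.
have -> : gf_poly M.+1 (Abar l) =
    gf_poly M.+1 (fun n => size (enum_overpartition l (l * M) n)).
  apply/polyP => i; rewrite !coef_poly; case: ifP => // iM.
  by rewrite (@Abar_size_enum _ (l * M)) //; lia.
have := gf_enum_overpartition (l * M) M.+1.
set A := gf_poly _ _; set PM := prod_coprime _ _; set PP := prod_coprime _ _ => hA.
have PE : prodP R (l * M) = PP * (prodP R M \Po 'X^l).
  rewrite /prodP (prod_coprime_mul (fun k => 1 + 'X^k)) // /PP; congr (_ * _).
  rewrite rmorph_prod; apply: eq_bigr => k _ /=.
  by rewrite comp_polyD comp_Xn_poly comp_polyC exprM.
have ME : prodM R (l * M) = PM * (prodM R M \Po 'X^l).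
  rewrite /prodM (prod_coprime_mul (fun k => 1 - 'X^k)) // /PM; congr (_ * _).
  rewrite rmorph_prod; apply: eq_bigr => k _ /=.
  by rewrite comp_polyB comp_Xn_poly comp_polyC exprM.
have h1 : eqX M.+1 (alt_theta R (l * M) * prodP R (l * M)) (prodM R (l * M)).
  by apply: eqX_weak (gauss R (l * M)).
have h2 := eqX_comp_Xn l0 (gauss R M); rewrite comp_polyM in h2.
apply: (@eqX_cancel _ _ (prodP R (l * M))); first exact: prodP0.
rewrite -mulrA [A * _]mulrC.
apply: eqX_trans (eqXMr A h1) _; rewrite ME {1}PE.
rewrite [X in eqX _ X _](_ : _ = A * PM * (prodM R M \Po 'X^l)); last by ring.
apply: eqX_trans (eqXMr _ hA) _.
rewrite mulrC [X in eqX _ _ X](_ : _ = (alt_theta R M \Po 'X^l) * (prodP R M \Po 'X^l) * PP);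
  last by ring.
by apply: eqXMr; apply: eqX_sym.
Qed.

End GeneratingFunction.

(** * Multisection of polynomials *)

Section Multisection.
Variable R : comNzRingType.

(** The operator U_m. For positive m the bound [size p] loses nothing, because m i >= i. *)
Definition every m (p : {poly R}) : {poly R} := \poly_(i < size p) p`_(m * i).

Lemma coef_every m p i : (0 < m)%N -> (every m p)`_i = p`_(m * i).
Proof.
move=> m0; rewrite coef_poly; case: ltnP => // h; rewrite nth_default //.
by apply: leq_trans h _; rewrite leq_pmull.
Qed.

Lemma every_mul_comp m p q : (0 < m)%N -> every m (p * (q \Po 'X^m)) = every m p * q.
Proof.
move=> m0; apply/polyP => n; rewrite coef_every //.
have qE : q = \sum_(i < size q) q`_i *: 'X^i by rewrite -poly_def coefK.
rewrite [in LHS]qE [in RHS]qE raddf_sum /= !mulr_sumr !coef_sum.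
apply: eq_bigr => i _; rewrite linearZ /= comp_Xn_poly -exprM -!scalerAr !coefZ !coefMXn.
by rewrite ltn_pmul2l // -mulnBr; case: ifP => //; rewrite coef_every.
Qed.

Lemma eqX_every m N p q : (0 < m)%N -> eqX (m * N).+1 p q -> eqX N.+1 (every m p) (every m q).
Proof.
move=> m0 /eqX_coef h; apply/eqX_coef => i iN; rewrite !coef_every // h //.
by rewrite ltnS leq_mul2l -ltnS iN orbT.
Qed.

End Multisection.

(** * Powers of theta and sums of squares *)

Section ThetaPowers.
Variable R : comNzRingType.

Lemma perm_zrangeS n :
  perm_eq (zrange n.+1) [:: Z.of_nat n.+1, (- Z.of_nat n.+1)%Z & zrange n].
Proof.
apply: uniq_perm; first exact: uniq_zrange.
  by rewrite 2!cons_uniq uniq_zrange in_cons !mem_zrange; lia.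
by move=> z; rewrite mem_zrange 2!in_cons mem_zrange; lia.
Qed.

(** As k and k^2 have the same parity, (-1)^k X^(k^2) = (-X)^(k^2). Products of such terms are then
    powers of -X with the norm as exponent, so all vectors of one norm contribute with the same
    sign. *)
Lemma alt_thetaE n : alt_theta R n = \sum_(z <- zrange n) (- 'X) ^+ Z.to_nat (z * z).
Proof.
elim: n => [|n IH].
  by rewrite /alt_theta big_ord0 addr0 /zrange /= big_seq1 expr0.
rewrite (perm_big _ (perm_zrangeS n)) 2!big_cons -IH /alt_theta.
have -> : Z.to_nat (Z.of_nat n.+1 * Z.of_nat n.+1) = (n.+1 ^ 2)%N by lia.
have sg : (-1) ^+ (n.+1 ^ 2) = (-1) ^+ n.+1 :> {poly R} by rewrite -signr_odd oddX signr_odd.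
by rewrite exprNn sg big_ord_recr /=; ring.
Qed.

Lemma sum_allpairs_mul (S T : Type) (s : seq S) (t : seq T) (F : S -> {poly R}) G :
  (\sum_(a <- s) F a) * (\sum_(b <- t) G b) =
  \sum_(x <- [seq (a, b) | a <- s, b <- t]) F x.1 * G x.2.
Proof. by rewrite big_allpairs_dep big_distrlr. Qed.

Lemma alt_theta3E n :
  alt_theta R n ^+ 3 = \sum_(x <- box3 n) (- 'X) ^+ Z.to_nat (norm3 x).
Proof.
rewrite exprSr expr2 !alt_thetaE !sum_allpairs_mul.
by apply: eq_bigr => -[[a b] c] _ /=; rewrite -!exprD; congr (_ ^+ _); nia.
Qed.

Lemma alt_theta4E n :
  alt_theta R n ^+ 4 = \sum_(x <- box4 n) (- 'X) ^+ Z.to_nat (norm4 x).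
Proof.
rewrite exprSr alt_theta3E !alt_thetaE !sum_allpairs_mul.
by apply: eq_bigr => -[[[a b] c] d] _ /=; rewrite -!exprD; congr (_ ^+ _); nia.
Qed.

Lemma coef_sum_signed (S : Type) (s : seq S) (N : S -> Z) m :
  (forall x, (0 <= N x)%Z) ->
  (\sum_(x <- s) (- 'X : {poly R}) ^+ Z.to_nat (N x))`_m =
  (-1) ^+ m * (size [seq x <- s | N x == Z.of_nat m])%:R.
Proof.
move=> N0; rewrite coef_sum; elim: s => [|x s IH]; first by rewrite big_nil mulr0.
rewrite big_cons IH -scaleN1r exprZn coefZ coefXn /=.
have -> : (m == Z.to_nat (N x)) = (N x == Z.of_nat m) by have := N0 x; lia.
case: eqP => [->|_]; last by rewrite mulr0 add0r.
by rewrite Nat2Z.id mulr1 /= -natr1 mulrDr mulr1 addrC.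
Qed.

Lemma coef_alt_theta3 n m : (alt_theta R n ^+ 3)`_m = (-1) ^+ m * (size (sol3 n m))%:R.
Proof. by rewrite alt_theta3E coef_sum_signed // => -[[a b] c] /=; nia. Qed.

Lemma coef_alt_theta4 n m : (alt_theta R n ^+ 4)`_m = (-1) ^+ m * (size (sol4 n m))%:R.
Proof. by rewrite alt_theta4E coef_sum_signed // => -[[[a b] c] d] /=; nia. Qed.

End ThetaPowers.

(** * Reduction modulo 5 and conclusion *)

Lemma alt_theta0 (R : comNzRingType) n : (alt_theta R n)`_0 = 1.
Proof.
rewrite /alt_theta coefD coef1 coef_sum big1 ?addr0 // => i _.
by rewrite coefMXn.
Qed.

Lemma Frobenius_poly_F5 (p : {poly 'F_5}) : p ^+ 5 = p \Po 'X^5.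
Proof.
have ch : 5%N \in [pchar {poly 'F_5}] by rewrite pchar_poly; apply: pchar_Fp.
elim/poly_ind: p => [|p c IH]; first by rewrite expr0n comp_poly0.
rewrite comp_poly_MXaddC -IH -!(pFrobenius_autE ch) rmorphD rmorphM /= !pFrobenius_autE.
by rewrite -rmorphXn /=; have := expf_card c; rewrite card_Fp // => ->.
Qed.

Lemma natF5_eq0 n : (n%:R == 0 :> 'F_5) = (5 %| n)%N.
Proof. by rewrite -(dvdn_pcharf (pchar_Fp (isT : prime 5))). Qed.

Lemma natF5_eq n m : n = m %[mod 5] -> n%:R = m%:R :> 'F_5.
Proof. by move=> h; rewrite -[LHS](@Fp_nat_mod 5) // -[RHS](@Fp_nat_mod 5) // h. Qed.

Lemma Abar_mul5 l M : (0 < l)%N ->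
  eqX M.+1 (every 5 (gf_poly 'F_5 (5 * M).+1 (Abar (5 * l))))
    (alt_theta 'F_5 (5 * l * (5 * M)) ^+ 3 * (alt_theta 'F_5 (5 * M) \Po 'X^l)).
Proof.
move=> l0; have l5 : (0 < 5 * l)%N by rewrite muln_gt0.
have := Abar_theta 'F_5 (5 * M) l5; set f := alt_theta _ (5 * l * _).
set g := alt_theta _ _; set A := gf_poly _ _ _ => h.
(* Multiplying by f^4 turns f into f^5 = f(X^5), so that on both sides a polynomial in X^5 can be
   pulled out of the multisection. *)
have {}h : eqX (5 * M).+1 (A * (f \Po 'X^5)) (f ^+ 4 * ((g \Po 'X^l) \Po 'X^5)).
  rewrite -Frobenius_poly_F5 exprS mulrA -comp_polyA comp_Xn_poly -exprM.
  by rewrite [f ^+ 4 * _]mulrC; apply: eqXMr.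
have := eqX_every (isT : (0 < 5)%N) h; rewrite !every_mul_comp // => {}h.
(* The signs agree since i and 5i have the same parity; the counts agree since r_4(5i) = r_4(i)
   modulo 5. *)
have f4 : eqX M.+1 (every 5 (f ^+ 4)) (f ^+ 4).
  apply/eqX_coef => i iM; rewrite coef_every // !coef_alt_theta4.
  rewrite -signr_odd oddM signr_odd; congr (_ * _); apply: natF5_eq; apply: size_sol4_mul5.
  nia.
apply: (@eqX_cancel _ _ f); first exact: alt_theta0.
apply: eqX_trans h (eqX_trans (eqXMr _ f4) _).
by rewrite exprS; rewrite [X in eqX _ _ X](_ : _ = f * f ^+ 3 * (g \Po 'X^l)) //; [apply: eqX_refl|ring].
Qed.

Local Close Scope ring_scope.

Theorem theorem11 (n alpha j i : nat) (halpha : 4 <= alpha)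
    (hj : 2 * j <= alpha - 4) (hi : i = 125 \/ i = 500) :
  Abar (5 ^ alpha) (5 ^ (2 * j) * (625 * n + i)) = 0 %[mod 5].
Proof.
have [e [eE e5]] : exists e, i = 125 * e /\ (e == 1) || (e == 4).
  by case: hi => ->; [exists 1|exists 4].
pose m := 25 ^ j.+1 * (5 * n + e).
have -> : 5 ^ (2 * j) * (625 * n + i) = 5 * m.
  by rewrite /m eE expnM -[5 ^ 2]/25 (expnS _ j); move: (25 ^ j) => x; lia.
have -> : 5 ^ alpha = 5 * 5 ^ alpha.-1 by rewrite -expnS prednK //; lia.
set l := 5 ^ alpha.-1.
(* The bound on j gives alpha - 1 >= 2(j + 1) + 1. *)
have [c lE] : exists c, l = 25 ^ j.+1 * 5 * c.
  exists (5 ^ (alpha.-1 - (2 * j.+1).+1)); rewrite -[25]/(5 ^ 2) -expnM -expnSr -expnD.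
  by congr (_ ^ _); lia.
have l0 : 0 < l by rewrite expn_gt0.
have /eqX_coef /(_ m (ltnSn m)) := Abar_mul5 m l0.
rewrite coef_every // coef_poly ltnSn coefMr big1 => [/eqP|k _].
  by rewrite natF5_eq0 => /eqP ->.
(* Only exponents k = d l occur in phi(q^l), so each remaining term carries the factor r_3(m - d l),
   up to sign. *)
rewrite coef_comp_poly_Xn //; case: ifP => [/dvdnP [d kd]|]; last by rewrite mulr0.
rewrite coef_alt_theta3.
suff -> : ((size (sol3 (5 * l * (5 * m)) (m - k)))%:R = 0 :> 'F_5)%R by rewrite mulr0 mul0r.
apply/eqP; rewrite natF5_eq0.
have -> : m - k = 25 ^ j.+1 * (5 * n + e - 5 * (c * d)).
  by rewrite kd /m lE mulnBr; congr (_ - _); lia.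
(* This excludes truncation in the natural subtraction, so 5n + e - 5cd is still e, that is 1 or 4,
   modulo 5. *)
have km : 25 ^ j.+1 * (5 * (c * d)) <= m.
  by rewrite -ltnS; apply: leq_trans (ltn_ord k); rewrite kd lE ltnS; apply/eq_leq; lia.
rewrite leq_pmul2l ?expn_gt0 // in km.
apply: size_sol3_25pow; last by lia.
apply: (@leq_trans m); first by rewrite leq_mul2l leq_subr orbT.
by rewrite mulnA leq_pmull // !muln_gt0 l0.
Qed.
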